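(* The following three statements are equivalent: (a) There exists a positive integer $n$ such that the fractional part of $\log S_n$ is given by $\{\log S_n\} = d_{2n} I_n$. (b) The formula $\{\log S_n\} = d_{2n} I_n$ holds for all sufficiently large positive integers $n$. (c) Euler's constant $\gamma$ is a rational number.
   Context: Here $\log$ is the natural logarithm; for real $x>0$, the fractional part $\{x\}$ is the number in $[0,1)$ with $x-\{x\}\in\mathbf{Z}$. Euler's constant is $\gamma := \lim_{N\to\infty}(H_N-\log N)$, where $H_N=\sum_{k=1}^N k^{-1}$. For a positive integer $m$, $d_m$ denotes the least common multiple of $1,2,\ldots,m$. For each positive integer $n$, $$I_n := \int_0^1\int_0^1 -\frac{(x(1-x)y(1-y))^n}{(1-xy)\log (xy)}\,dx\,dy,$$ $$S_n := \prod_{k=1}^{n}\ \prod_{i=0}^{\min(k-1,\,n-k)}\ \prod_{j=i+1}^{n-i} (n+k)^{\frac{2d_{2n}}{j}\binom{n}{i}^2},$$ the latter being a positive integer (each $j$ occurring divides $d_{2n}$). *)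

(* Defs.v *)
From HB Require Import structures.
From mathcomp Require Import all_boot all_order all_algebra.
From mathcomp Require Import all_classical all_reals all_analysis.

Set Implicit Arguments.
Unset Strict Implicit.
Unset Printing Implicit Defensive.

Import Order.TTheory GRing.Theory Num.Theory.
Import numFieldNormedType.Exports.

Local Open Scope classical_set_scope.
Local Open Scope ring_scope.

Definition frac_part (R : realType) (x : R) : R := x - (Num.floor x)%:~R.

Definition harmonic_sum (R : realType) (N : nat) : R :=
  \sum_(1 <= k < N.+1) k%:R^-1.

Definition euler_gamma (R : realType) : R :=
  limn (fun N : nat => harmonic_sum R N - ln N%:R).

Definition lcm_upto (m : nat) : nat := \big[lcmn/1%N]_(1 <= k < m.+1) k.

(* Since ln 0 = 0 and 0^-1 = 0 here, the integrand takes the value 0 on the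
   null set where x = 0, y = 0 or x = y = 1. Elsewhere on the unit square it is
   nonnegative, and it is bounded for n > 0, so both integrals are finite. *)
Definition I_int (R : realType) (n : nat) : R :=
  \int[@lebesgue_measure R]_(y in `[0, 1])
    \int[@lebesgue_measure R]_(x in `[0, 1])
      (- ((x * (1 - x) * y * (1 - y)) ^+ n / ((1 - x * y) * ln (x * y)))).

(* Every j below lies between 1 and n, so the division by j is exact. *)
Definition S_prod (n : nat) : nat :=
  (\prod_(1 <= k < n.+1)
     \prod_(0 <= i < (minn (k - 1) (n - k)).+1)
       \prod_(i.+1 <= j < (n - i).+1)
         (n + k) ^ ((2 * lcm_upto (2 * n)) %/ j * 'C(n, i) ^ 2))%N.

(* Main.v *)
Require Import Defs.
From HB Require Import structures.
From mathcomp Require Import all_boot all_order all_algebra.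
From mathcomp Require Import all_classical all_reals all_analysis.
From mathcomp Require Import measurable_realfun measurable_fun_approximation.
From mathcomp Require Import zify ring lra.
Import Order.TTheory GRing.Theory Num.Theory.
Import numFieldNormedType.Exports.
Local Open Scope classical_set_scope.
Local Open Scope ring_scope.

(** Write d for lcm(1, ..., 2n). Everything follows from an identity of Sondow,

      d I_n = p gamma + ln S_n - a,

    where p = d (C(n, 0)^2 + ... + C(n, n)^2) and a are integers
    ([sondow_identity]), together with the fact that d I_n lies in [0, 1[ for
    large n ([lcm_upto_I_int_lt1]).

    If d I_n is the fractional part of ln S_n for a single n, the identity shows
    that p gamma is an integer, so gamma is rational. Conversely, if gamma is
    rational, its denominator divides d, hence p, as soon as n is large; then
    d I_n and ln S_n differ by an integer, and d I_n, being in [0, 1[, is the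
    fractional part of ln S_n.

    The identity. For 0 < u < 1 the factor 1 / ((1 - u) (- ln u)) is the integral of
    (floor t + 1) u^t over t >= 0: sum the integrals over [k, +oo[. Taking u = xy and
    applying Tonelli's theorem separates the variables. Each of x and y contributes
    a beta integral, namely n! / (s (s + 1) ... (s + n)) at s = n + 1 + t
    ([integral_beta_kernel]), whose partial fraction expansion is [beta_sum]. Thus
    I_n is the series over k of the integrals over [k, +oo[ of the square of
    [beta_sum] ([sondow_outer]). The square has double poles with coefficients
    C(n, i)^2 and simple poles with residues 2 C(n, i)^2 (H_i - H_(n - i))
    ([beta_sum_sq], [sum_pf_cross]), so its antiderivative is explicit, and summing
    it over integers produces harmonic numbers and logarithms. Two relations among
    the residues ([sum_log_coef], [sum_log_coef_index]) cancel the divergent terms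
    and leave multiples of H_N - ln N, whose limit is gamma
    ([cvg_sum_pf_prim]). The logarithms that remain form ln S_n / d ([ln_S_prod]),
    and the harmonic numbers have index at most 2n, so d clears their denominators.

    The bound. The integrand is at most 16^(1 - n) ([sondow_integrand_le]). Since d
    is the least common multiple of 2n integers, a bound d <= K r^(2n) with r < 4 is
    required; it comes from the integrality of (6n)! / ((3n)! (2n)! n!)
    ([lcm_upto_6n], [lcm_upto_bound]). *)

(** * The growth of the least common multiple of 1, ..., m *)

Lemma lcm_uptoS m : lcm_upto m.+1 = lcmn (lcm_upto m) m.+1.
Proof. by rewrite /lcm_upto big_nat_recr. Qed.

Lemma lcm_upto_gt0 m : (0 < lcm_upto m)%N.
Proof.
elim: m => [|m IH]; first by rewrite /lcm_upto big_geq.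
by rewrite lcm_uptoS lcmn_gt0 IH.
Qed.

Lemma dvdn_lcm_upto m k : (0 < k <= m)%N -> (k %| lcm_upto m)%N.
Proof.
elim: m => [|m IH]; first by case: k.
case/andP=> k0; rewrite leq_eqVlt ltnS lcm_uptoS => /orP[/eqP ->|km].
  exact: dvdn_lcmr.
by apply: dvdn_trans (dvdn_lcml _ _); apply: IH; rewrite k0.
Qed.

Lemma lcm_upto_dvdn m x :
  (forall k, (0 < k <= m)%N -> (k %| x)%N) -> (lcm_upto m %| x)%N.
Proof.
elim: m => [|m IH] H; first by rewrite /lcm_upto big_geq // dvd1n.
rewrite lcm_uptoS dvdn_lcm (H m.+1) ?leqnn // andbT; apply: IH => k /andP[k0 km].
by apply: H; rewrite k0 leqW.
Qed.

Lemma leq_lcm_upto m n : (m <= n)%N -> (lcm_upto m <= lcm_upto n)%N.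
Proof.
move=> mn; apply: dvdn_leq (lcm_upto_gt0 n) _.
apply: lcm_upto_dvdn => k /andP[k0 km]; apply: dvdn_lcm_upto.
by rewrite k0 (leq_trans km).
Qed.

Lemma logn_fact_widen p m N : prime p -> (m <= N)%N ->
  logn p m`! = (\sum_(1 <= k < N.+1) m %/ p ^ k)%N.
Proof.
move=> pp mN; rewrite logn_fact // [RHS](@big_cat_nat _ _ _ m.+1) //=.
rewrite [X in (_ + X)%N]big_nat_cond [X in (_ + X)%N]big1 ?addn0 // => k.
rewrite andbT => /andP[mk _]; apply: divn_small.
exact: leq_trans mk (ltnW (ltn_expl k (prime_gt1 pp))).
Qed.

(** This is the multinomial coefficient (6n)! / ((3n)! (2n)! n!), written as a
    product of two binomials to avoid a division in [nat]. *)
Definition multinom632 n := ('C(6 * n, 3 * n) * 'C(3 * n, n))%N.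

Lemma multinom632_fact n :
  (multinom632 n * ((3 * n)`! * (2 * n)`! * n`!) = (6 * n)`!)%N.
Proof.
have h1 : ('C(6 * n, 3 * n) * ((3 * n)`! * (3 * n)`!) = (6 * n)`!)%N.
  by rewrite -[in RHS](@bin_fact (6 * n) (3 * n)); [congr (_ * (_ * _`!))%N|]; lia.
have h2 : ('C(3 * n, n) * (n`! * (2 * n)`!) = (3 * n)`!)%N.
  by rewrite -[in RHS](@bin_fact (3 * n) n); [congr (_ * (_ * _`!))%N|]; lia.
by rewrite -h1 -[in X in (_ = _ * (_ * X))%N]h2 /multinom632; ring.
Qed.

(** With y = n / q, floor(6y) - floor(3y) - floor(2y) - floor(y) is never
    negative and is at least 1 for 1/6 <= y < 1. Summed over prime powers q this
    is why [multinom632] absorbs the part of lcm(1, ..., 6n) beyond n. *)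
Lemma leq_divn_632 n q : (0 < q)%N ->
  ((3 * n) %/ q + (2 * n) %/ q + n %/ q + (n < q <= 6 * n) <= (6 * n) %/ q)%N.
Proof.
move=> q0; rewrite leq_divRL //.
have h1 := leq_trunc_div n q; have h2 := leq_trunc_div (2 * n) q.
have h3 := leq_trunc_div (3 * n) q.
case: (boolP (n < q <= 6 * n)%N) => [/andP[nq q6]|_]; last first.
  by rewrite addn0 !mulnDl; lia.
move: h1 h2 h3; rewrite (divn_small nq).
have : ((3 * n) %/ q < 3)%N by rewrite ltn_divLR //; lia.
have : ((2 * n) %/ q < 2)%N by rewrite ltn_divLR //; lia.
move: ((2 * n) %/ q)%N ((3 * n) %/ q)%N => u v.
by move: u => [|[|//]]; move: v => [|[|[|//]]] _ _ /=; lia.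
Qed.

(** Compare p-adic valuations: by Legendre's formula, each power p^i with
    n < p^i <= 6n contributes at least 1 to the valuation of [multinom632], and
    the powers p^i <= n already divide lcm(1, ..., n). *)
Lemma lcm_upto_6n n : (lcm_upto (6 * n) %| lcm_upto n * multinom632 n)%N.
Proof.
have M0 : (0 < multinom632 n)%N by rewrite muln_gt0 !bin_gt0; lia.
have D0 := lcm_upto_gt0 n.
move: (multinom632 n) M0 (multinom632_fact n) => M M0 MF.
apply: lcm_upto_dvdn => k /andP[k0 k6].
apply/dvdn_partP => // p; rewrite mem_primes => /and3P[pp _ _].
rewrite p_part; set v := logn p k.
have p1 := prime_gt1 pp; have p0 := prime_gt0 pp.
have pv6 : (p ^ v <= 6 * n)%N.
  by apply: leq_trans k6; apply: dvdn_leq => //; exact: pfactor_dvdnn.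
have n0 : (0 < n)%N by lia.
have DM0 : (0 < lcm_upto n * M)%N by rewrite muln_gt0 D0.
rewrite (pfactor_dvdn _ pp DM0).
rewrite lognM //.
(* p ^ a is the largest power of p that lcm(1, ..., n) is known to absorb. *)
set a := trunc_log p n.
have [pan npa] : (p ^ a <= n /\ n < p ^ a.+1)%N.
  by split; [exact: trunc_logP | exact: trunc_log_ltn].
have la : (a <= logn p (lcm_upto n))%N.
  rewrite -pfactor_dvdn //; apply: dvdn_lcm_upto.
  by rewrite expn_gt0 p0.
suff: (v - a <= logn p M)%N by lia.
have v6 : (v <= 6 * n)%N by apply: leq_trans pv6; exact: ltnW (ltn_expl _ _).
have /(congr1 (logn p)) := MF.
rewrite !lognM ?muln_gt0 ?fact_gt0 //.
rewrite !(@logn_fact_widen p _ (6 * n)) //; try lia.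
rewrite -!big_split /= => E.
have : (\sum_(1 <= k < (6 * n).+1) ((3 * n) %/ p ^ k + (2 * n) %/ p ^ k
          + n %/ p ^ k) + \sum_(1 <= k < (6 * n).+1) (n < p ^ k <= 6 * n)
        <= \sum_(1 <= k < (6 * n).+1) (6 * n) %/ p ^ k)%N.
  rewrite -big_split /=; apply: leq_sum => i _.
  by apply: leq_divn_632; rewrite expn_gt0 p0.
rewrite -E addnC leq_add2r; apply: leq_trans.
have [va|av] := leqP v a; first by rewrite (eqP va).
rewrite (@big_cat_nat _ _ _ a.+1) //=; last by lia.
rewrite (@big_cat_nat _ _ _ v.+1 a.+1) //=; try lia.
rewrite [X in (_ <= _ + (X + _))%N](_ : _ = (v - a)%N); first lia.
rewrite -[RHS]muln1 -(subSS a v) -sum_nat_const_nat.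
apply: eq_big_nat => i /andP[ai iv].
have -> : (n < p ^ i)%N.
  by apply: leq_trans npa _; rewrite leq_exp2l.
by rewrite (leq_trans _ pv6) // leq_exp2l.
Qed.

Lemma bin_exp_le m k a b : (k <= m)%N ->
  ('C(m, k) * (a ^ (m - k) * b ^ k) <= (a + b) ^ m)%N.
Proof.
by move=> km; rewrite expnDn (bigD1 (Ordinal (km : k < m.+1)%N)) //= leq_addr.
Qed.

(** 432 = 6^6 / (3^3 2^2). The multinomial is bounded factor by factor, keeping one
    term of (1 + 1)^(6n) and one of (2 + 1)^(3n): 2^6 * 3^3 = 432 * 2^2. *)
Lemma multinom632_le n : (multinom632 n <= 432 ^ n)%N.
Proof.
have h1 := @bin_exp_le (6 * n) (3 * n) 1 1 ltac:(lia).
have h2 := @bin_exp_le (3 * n) n 2 1 ltac:(lia).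
move: h1 h2; rewrite !exp1n !muln1 -(_ : (2 * n)%N = (3 * n - n)%N); last lia.
move=> h1 h2; rewrite -(@leq_pmul2r (2 ^ (2 * n))) ?expn_gt0 //.
rewrite /multinom632 -mulnA; apply: leq_trans (leq_mul h1 h2) _.
by rewrite !expnM -!expnMn.
Qed.

(** A loss of one extra factor z is paid by the slack a in a * z <= c ^ 6, as soon
    as q is large enough for a ^ q to exceed z. *)
Lemma exprS_le_slack (R : realFieldType) (z a c : R) (q r : nat) :
  0 <= z -> 0 <= a -> 1 <= c -> z <= a ^+ q -> a * z <= c ^+ 6 ->
  z ^+ q.+1 <= c ^+ (6 * q + r).
Proof.
move=> z0 a0 c1 zq zc; have c0 : 0 <= c := le_trans ler01 c1.
rewrite exprS exprD exprM; apply: (@le_trans _ _ (c ^+ 6 ^+ q)).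
  apply: (@le_trans _ _ ((a * z) ^+ q)).
    by rewrite exprMn ler_wpM2r ?exprn_ge0.
  by rewrite lerXn2r ?nnegrE ?mulr_ge0 ?exprn_ge0.
by rewrite ler_peMr ?exprn_ge0 // exprn_ege1.
Qed.

(** Any base below 4 would do, since the double integral decays like 16^(-n)
    against lcm(1, ..., 2n); the elementary base 4 itself would not suffice.
    By [lcm_upto_6n] the passage from index n to index 6n costs a factor 432^n, which
    leaves room for any base larger than 432^(1/5), about 3.37. *)
Lemma lcm_upto_bound (R : realFieldType) :
  exists2 K : R, 0 < K & forall m, (lcm_upto m)%:R <= K * (15 / 4) ^+ m.
Proof.
(* 120 makes the quotient by 6 at least 19, which is what makes (3 / 2) ^ 19
   larger than 15 / 4 * 432 = 1620 below. *)
pose K : R := (lcm_upto 120)%:R.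
have K0 : 0 < K by rewrite ltr0n lcm_upto_gt0.
exists K => //; elim/ltn_ind => m IH.
have [m120|m120] := leqP m 120.
  apply: (@le_trans _ _ K); first by rewrite ler_nat leq_lcm_upto.
  by rewrite ler_peMr ?(ltW K0) // exprn_ege1 //; lra.
set q := (m %/ 6)%N; set n := q.+1; set r := (m %% 6)%N.
have mE : m = (6 * q + r)%N by rewrite mulnC -divn_eq.
have r6 : (r < 6)%N by rewrite ltn_mod.
have q19 : (19 <= q)%N by lia.
have dm : (lcm_upto m <= lcm_upto n * 432 ^ n)%N.
  apply: (@leq_trans (lcm_upto (6 * n))); first by apply: leq_lcm_upto; lia.
  apply: (@leq_trans (lcm_upto n * multinom632 n)).
    by apply: dvdn_leq (lcm_upto_6n n); rewrite muln_gt0 lcm_upto_gt0 muln_gt0 !bin_gt0; lia.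
  by rewrite leq_mul2l multinom632_le orbT.
apply: (@le_trans _ _ ((lcm_upto n)%:R * 432%:R ^+ n)).
  by rewrite -natrX -natrM ler_nat.
have z0 : 0 < 432%:R :> R by rewrite ltr0n.
have zq : 15 / 4 * 432%:R <= (3 / 2) ^+ 19 :> R by lra.
have zc : 3 / 2 * (15 / 4 * 432%:R) <= (15 / 4) ^+ 6 :> R by lra.
have c1 : 1 <= 15 / 4 :> R by lra.
have a1 : 1 <= 3 / 2 :> R by lra.
move: (15 / 4) (3 / 2) 432%:R c1 a1 z0 zq zc IH => c a z c1 a1 z0 zq zc IH.
apply: (@le_trans _ _ (K * c ^+ n * z ^+ n)).
  by rewrite ler_pM2r ?exprn_gt0 // IH //; lia.
have c0 : 0 <= c := le_trans ler01 c1.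
have a0 : 0 <= a := le_trans ler01 a1.
rewrite -mulrA -exprMn ler_wpM2l ?(ltW K0) // mE.
apply: (@exprS_le_slack _ _ a); rewrite ?mulr_ge0 ?(ltW z0) //.
by apply: le_trans zq _; exact: ler_weXn2l.
Qed.

(** * Partial fractions of a squared beta sum *)

Section PartialFractions.
Variable R : realType.
Implicit Types (n i j k : nat) (s : R).

Local Notation H := (harmonic_sum R).
Local Notation b n i := ('C(n, i)%:R : R).

Lemma harmonic_sumS n : H n.+1 = H n + n.+1%:R^-1.
Proof. by rewrite /harmonic_sum big_nat_recr. Qed.

Lemma harmonic_sum0 : H 0 = 0.
Proof. by rewrite /harmonic_sum big_geq. Qed.

(** The numerator of 1 / ((s + i) (s + j)) in the expanded square of
    [beta_sum]. *)
Definition pf_num n i j : R := (-1) ^+ (i + j) * b n i * b n j.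

(** For i <> j, w / ((s + i) (s + j)) = t / (s + i) - t / (s + j) with
    t = w / (j - i). Since the inverse of 0 is 0, the value for i = j is 0, so that
    double sums of [pf_cross] need no side condition. *)
Definition pf_cross n i j : R := pf_num n i j / (j%:R - i%:R).

(** The residue at s = - i of the square of [beta_sum], hence the coefficient of
    ln (s + i) in its antiderivative. *)
Definition log_coef n i : R := 2 * b n i ^+ 2 * (H i - H (n - i)).

(** The partial fraction expansion of n! / (s (s + 1) ... (s + n)), that is, of
    the integral of x^(s - 1) (1 - x)^n over the unit interval. *)
Definition beta_sum n s : R := \sum_(i < n.+1) (-1) ^+ i * b n i / (s + i%:R).

Lemma pf_crossC n i j : pf_cross n j i = - pf_cross n i j.
Proof.
rewrite /pf_cross /pf_num -(opprB j%:R) invrN mulrN addnC; congr (- _).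
by rewrite -!mulrA; congr (_ * _); rewrite mulrCA.
Qed.

Lemma pf_num_cross n i j :
  pf_num n i j = (j%:R - i%:R) * pf_cross n i j + (i == j)%:R * pf_num n i i.
Proof.
case: eqVneq => [->|ij]; first by rewrite subrr mul0r add0r mul1r.
rewrite mul0r addr0 /pf_cross mulrC divfK // subr_eq0 eqr_nat eq_sym.
exact: ij.
Qed.

Lemma sum_pf_num_diag n (f : nat -> R) :
  \sum_(i < n.+1) \sum_(j < n.+1) ((i : nat) == j)%:R * f i
  = \sum_(i < n.+1) f i.
Proof.
apply: eq_bigr => i _; rewrite (bigD1 i) //= eqxx mul1r big1 ?addr0 // => j ji.
by rewrite (_ : (i : nat) == j = false) ?mul0r // eq_sym; apply/negbTE.
Qed.

Lemma pf_num_diag n i : pf_num n i i = b n i ^+ 2.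
Proof. by rewrite /pf_num addnn -mul2n exprM sqrrN expr1n expr1n mul1r. Qed.

Lemma sum_pf_num n : (0 < n)%N ->
  \sum_(i < n.+1) \sum_(j < n.+1) pf_num n i j = 0.
Proof.
move=> n0; have alt : \sum_(i < n.+1) (-1) ^+ i * b n i = 0 :> R.
  transitivity ((1 - 1 : R) ^+ n); last by rewrite subrr expr0n; case: n n0.
  rewrite exprBn; apply: eq_bigr => i _.
  by rewrite !expr1n !mulr1 mulr_natr.
transitivity ((\sum_(i < n.+1) (-1) ^+ i * b n i) ^+ 2); last by rewrite alt expr0n.
rewrite expr2 mulr_suml; apply: eq_bigr => i _; rewrite mulr_sumr.
by apply: eq_bigr => j _; rewrite /pf_num exprD; ring.
Qed.

Lemma sum_beta_inv1 n : \sum_(i < n.+1) (-1) ^+ i * b n i / i.+1%:R = n.+1%:R^-1.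
Proof.
have n1 : n.+1%:R != 0 :> R by rewrite pnatr_eq0.
apply: (mulfI n1); rewrite divff // mulr_sumr.
transitivity (1 - \sum_(i < n.+2) (-1) ^+ i * b n.+1 i : R); last first.
  rewrite (_ : \sum_(i < n.+2) _ = (1 - 1 : R) ^+ n.+1).
    by rewrite subrr expr0n subr0.
  by rewrite exprBn; apply: eq_bigr => i _; rewrite !expr1n !mulr1 mulr_natr.
rewrite [in RHS]big_ord_recl /= expr0 bin0 mul1r opprD addrA subrr sub0r -sumrN.
apply: eq_bigr => i _; rewrite /bump leq0n add1n exprS mulN1r mulNr opprK.
rewrite -!mulrA mulrCA; congr (_ * _); rewrite mulrA -natrM mul_bin_diag natrM mulrC.
by rewrite mulrA mulVf ?mul1r // pnatr_eq0.
Qed.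

Lemma natrBSS i j : j.+1%:R - i.+1%:R = j%:R - i%:R :> R.
Proof. by rewrite -!natr1 opprD addrACA subrr addr0. Qed.

(** The constant term at s = - i of [beta_sum], up to the sign (-1)^i; again the
    term j = i vanishes by the convention on the inverse of 0. *)
Definition pf_const n i : R :=
  \sum_(j < n.+1) (-1) ^+ (i + j) * b n j / (j%:R - i%:R).

(** Pascal's rule, applied to the binomials and combined with the shift of the
    summation index; this recursion determines [pf_const]. *)
Lemma pf_constS n i : pf_const n.+1 i.+1 = pf_const n i + pf_const n i.+1.
Proof.
rewrite /pf_const big_ord_recl.
under eq_bigr => j _.
  rewrite /= /bump leq0n add1n addSn addnS !exprS !mulN1r opprK binS natrD.
  rewrite mulrDr mulrDl natrBSS; over.
rewrite big_split /= addrA addrC; congr (_ + _).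
rewrite [RHS]big_ord_recl /= !bin0; congr (_ + _).
rewrite [LHS]big_ord_recr /= bin_small // mulr0 mul0r addr0.
apply: eq_bigr => j _; rewrite /bump leq0n add1n addSn addnS !exprS !mulN1r opprK.
by rewrite natrBSS.
Qed.

Lemma pf_const0 n : pf_const n 0 = - H n.
Proof.
elim: n => [|n IH].
  by rewrite /pf_const big_ord1 subrr invr0 mulr0 harmonic_sum0 oppr0.
rewrite harmonic_sumS opprD -IH -sum_beta_inv1 /pf_const big_ord_recl.
rewrite subr0 invr0 mulr0 add0r [in RHS]big_ord_recl subr0 invr0 mulr0 add0r.
under eq_bigr => j _.
  rewrite subr0 /= /bump leq0n add1n add0n exprS mulN1r binS natrD.
  rewrite mulrDr mulrDl !mulNr; over.
rewrite big_split /= sumrN; congr (_ + _); last by rewrite sumrN.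
rewrite big_ord_recr /= bin_small // mulr0 mul0r addr0 -sumrN.
apply: eq_bigr => j _.
by rewrite subr0 /bump leq0n add1n add0n exprS mulN1r !mulNr.
Qed.

Lemma pf_const_rev n : pf_const n n = - pf_const n 0.
Proof.
rewrite /pf_const (reindex_inj rev_ord_inj) -sumrN; apply: eq_bigr => j _ /=.
have jn : (j <= n)%N by rewrite -ltnS.
rewrite subSS bin_sub // subr0 natrB // addrAC subrr sub0r invrN mulrN; congr (- (_ * _ / _)).
have -> : (n + (n - j) = 0 + j + (n - j).*2)%N by rewrite -addnn; lia.
by rewrite exprD -mul2n exprM sqrrN !expr1n mulr1.
Qed.

(** Induction along Pascal's triangle. The two edges i = 0 and i = n are treated
    apart, because the recursion reaches outside the triangle there. *)
Lemma pf_constE n i : (i <= n)%N -> pf_const n i = b n i * (H i - H (n - i)).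
Proof.
elim: n i => [|n IH] [|i] //; rewrite ?pf_const0 ?subn0 ?bin0 ?harmonic_sum0 ?mul1r ?sub0r //.
rewrite ltnS leq_eqVlt => /orP[/eqP ->|lt_in].
  by rewrite pf_const_rev pf_const0 opprK subnn binn harmonic_sum0 subr0 mul1r.
rewrite pf_constS !IH //; last exact: ltnW.
have e : (n - i = (n - i.+1).+1)%N by lia.
rewrite subSS e !harmonic_sumS binS natrD -e.
have i1 : i.+1%:R != 0 :> R by rewrite pnatr_eq0.
have ni : (n - i)%:R != 0 :> R by rewrite pnatr_eq0; lia.
have : b n i.+1 * i.+1%:R = b n i * (n - i)%:R.
  by rewrite -!natrM mulnC mul_bin_left mulnC.
move=> E; have -> : b n i.+1 = b n i * (n - i)%:R / i.+1%:R.
  by rewrite -E mulfK.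
by field; rewrite ni nat1r i1.
Qed.

Lemma sum_pf_cross n i : (i <= n)%N ->
  2 * \sum_(j < n.+1) pf_cross n i j = log_coef n i.
Proof.
move=> le_in; rewrite /log_coef expr2 -!mulrA -pf_constE //.
by congr (_ * _); rewrite mulr_sumr; apply: eq_bigr => j _; rewrite /pf_cross /pf_num; ring.
Qed.

(** Exchanging the two summations turns the sum into its opposite. *)
Lemma sum_antisym n (f : nat -> nat -> R) : (forall i j, f j i = - f i j) ->
  \sum_(i < n) \sum_(j < n) f i j = 0.
Proof.
move=> fC; have : \sum_(i < n) \sum_(j < n) f i j = - \sum_(i < n) \sum_(j < n) f i j.
  rewrite -[in RHS]sumrN [LHS]exchange_big /=; apply: eq_bigr => i _.
  by rewrite -sumrN; apply: eq_bigr => j _; rewrite fC.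
lra.
Qed.

(** The residues add up to 0, so the antiderivative of the square of [beta_sum] has
    a finite limit at infinity. *)
Lemma sum_log_coef n : \sum_(i < n.+1) log_coef n i = 0.
Proof.
under eq_bigr => i _ do rewrite -sum_pf_cross -1?ltnS //.
rewrite -mulr_sumr (sum_antisym n.+1 (pf_cross n)) ?mulr0 // => i j.
exact: pf_crossC.
Qed.

(** This makes the divergent multiples of ln N cancel in the sum of the
    antiderivative over the integers. Symmetrizing, twice the sum of i t_ij is the
    sum of (i - j) t_ij for t = [pf_cross], that is, minus the off-diagonal part of
    the square of the alternating sum of binomials. As that square is 0, its
    diagonal part is what is left. *)
Lemma sum_log_coef_index n : (0 < n)%N ->
  \sum_(i < n.+1) i%:R * log_coef n i = \sum_(i < n.+1) b n i ^+ 2.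
Proof.
move=> n0; have := sum_pf_num n n0.
under eq_bigr => i _ do under eq_bigr => j _ do rewrite pf_num_cross.
under eq_bigr => i _ do rewrite big_split /=.
rewrite big_split /= (sum_pf_num_diag n (fun i => pf_num n i i)).
under [in X in _ + X]eq_bigr => i _ do rewrite pf_num_diag.
set A := \sum_(i < n.+1) \sum_(j < n.+1) (i%:R * pf_cross n i j).
have -> : \sum_(i < n.+1) \sum_(j < n.+1) (j%:R - i%:R) * pf_cross n i j = - A - A.
  under eq_bigr => i _ do under eq_bigr => j _ do rewrite mulrBl.
  under eq_bigr => i _ do rewrite sumrB.
  rewrite sumrB; congr (_ - _); rewrite exchange_big /= -sumrN.
  apply: eq_bigr => i _; rewrite -sumrN; apply: eq_bigr => j _.
  by rewrite pf_crossC mulrN.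
have -> : \sum_(i < n.+1) i%:R * log_coef n i = 2 * A.
  rewrite mulr_sumr; apply: eq_bigr => i _.
  by rewrite -sum_pf_cross -1?ltnS // mulrCA mulr_sumr.
lra.
Qed.

Lemma beta_sum_sq n s : 0 < s ->
  beta_sum n s ^+ 2 =
  \sum_(i < n.+1) (b n i ^+ 2 / (s + i%:R) ^+ 2 + log_coef n i / (s + i%:R)).
Proof.
move=> s0; have si i : s + i%:R != 0 by rewrite gt_eqF // ltr_pwDl.
rewrite big_split /= expr2 {1}/beta_sum mulr_suml.
transitivity (\sum_(i < n.+1) \sum_(j < n.+1)
   ((pf_cross n i j / (s + i%:R) - pf_cross n i j / (s + j%:R))
     + ((i : nat) == j)%:R * (pf_num n i i / (s + i%:R) ^+ 2))).
  apply: eq_bigr => i _; rewrite /beta_sum mulr_sumr; apply: eq_bigr => j _.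
  transitivity (pf_num n i j / ((s + i%:R) * (s + j%:R))).
    by rewrite /pf_num exprD; field; rewrite !si.
  rewrite [in LHS]pf_num_cross; case: eqVneq => [->|_].
    by field; rewrite !si.
  by rewrite !mul0r !addr0; field; rewrite !si.
under [LHS]eq_bigr => i _ do rewrite big_split sumrB /=.
rewrite big_split /= (sum_pf_num_diag n (fun i => pf_num n i i / (s + i%:R) ^+ 2)).
under [X in _ + X = _]eq_bigr => i _ do rewrite pf_num_diag.
rewrite addrC; congr (_ + _); rewrite sumrB [X in _ - X]exchange_big /=.
rewrite -sumrB; apply: eq_bigr => i _; rewrite -sum_pf_cross -1?ltnS //.
under [X in _ - X]eq_bigr => j _ do rewrite pf_crossC mulNr.
by rewrite sumrN -!mulr_suml; ring.
Qed.

Lemma log_coef_rev n i : (i <= n)%N -> log_coef n (n - i) = - log_coef n i.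
Proof. by move=> le_in; rewrite /log_coef bin_sub // subKn // -mulrN opprB. Qed.

Lemma sum_nat_shift0 (f : nat -> R) i k :
  \sum_(i <= j < k) f j = \sum_(0 <= j < k - i) f (j + i)%N.
Proof. exact: (big_addn 0 k i predT f). Qed.

Lemma sum_log_coef_rev n i k : (i <= k)%N -> (k <= n)%N ->
  \sum_(i <= j < k.+1) log_coef n j = - \sum_(n - k <= j < (n - i).+1) log_coef n j.
Proof.
move=> ik kn; rewrite big_nat_rev -sumrN /= (sum_nat_shift0 _ i) (sum_nat_shift0 _ (n - k)).
have -> : ((n - i).+1 - (n - k) = k.+1 - i)%N by lia.
apply: eq_big_nat => j /= jk.
by rewrite -log_coef_rev; [congr log_coef|]; lia.
Qed.

(** The antisymmetry of [log_coef] under i -> n - i turns the tail from k into minus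
    the head up to n - k, in which the terms from k on cancel in pairs. In what
    remains i < n - i, so the difference of harmonic numbers is a sum over j. *)
Lemma sum_log_coef_tail n k : (0 < k <= n)%N ->
  \sum_(k <= i < n.+1) log_coef n i
  = \sum_(0 <= i < (minn (k - 1) (n - k)).+1)
      \sum_(i.+1 <= j < (n - i).+1) 2 * b n i ^+ 2 / j%:R.
Proof.
move=> /andP[k0 kn].
transitivity (- \sum_(0 <= i < (minn (k - 1) (n - k)).+1) log_coef n i); last first.
  rewrite -sumrN; apply: eq_big_nat => i /= im.
  rewrite -mulr_sumr /log_coef -mulrN opprB; congr (_ * _).
  apply/eqP; rewrite subr_eq; apply/eqP.
  by rewrite addrC /harmonic_sum -big_cat_nat //=; lia.
rewrite sum_log_coef_rev // subnn; congr (- _).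
have [kk|kk] := leqP (n - k) (k - 1); first by [].
rewrite (@big_cat_nat _ _ _ (k - 1).+1) //=; last lia.
rewrite [X in _ + X](_ : _ = 0) ?addr0 //.
have := @sum_log_coef_rev n k (n - k) ltac:(lia) ltac:(lia).
rewrite subKn // (_ : (k - 1).+1 = k); last lia.
lra.
Qed.

End PartialFractions.

(** * Euler's constant as the limit of a telescoped series *)

Section Gamma.
Variable R : realType.
Implicit Types (n i j k N M : nat) (s : R).

Local Notation H := (harmonic_sum R).
Local Notation b n i := ('C(n, i)%:R : R).
Local Notation c n i := (log_coef R n i).

Lemma cvg_sumr (I : Type) (r : seq I) (P : pred I) (u : I -> nat -> R) (l : I -> R) :
  (forall x, P x -> u x @ \oo --> l x) ->
  (fun N => \sum_(x <- r | P x) u x N) @ \oo --> \sum_(x <- r | P x) l x.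
Proof.
move=> ul; apply: cvg_big => //; exact: add_continuous.
Qed.

Lemma lnS_natD_le N m : ln (N.+1 + m)%:R - ln N.+1%:R <= m%:R / N.+1%:R :> R.
Proof.
have N0 : (0 : R) < N.+1%:R by rewrite ltr0n.
rewrite -ln_div ?posrE ?ltr0n ?addSn // -addSn natrD mulrDl divff ?gt_eqF //.
by apply: le_ln1Dx; apply: lt_le_trans (_ : 0 <= _) => //; rewrite divr_ge0.
Qed.

Lemma cvg_ln_natD m : (fun N => ln (N + m)%:R - ln N%:R : R) @ \oo --> (0 : R).
Proof.
rewrite -cvg_shiftS /=.
apply: (@squeeze_cvgr _ _ _ _ (fun=> 0) (fun N => m%:R * harmonic N)).
- near=> N; rewrite lnS_natD_le andbT subr_ge0 ler_ln ?posrE ?ltr0n ?addSn //.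
  by rewrite ler_nat ltnS leq_addr.
- exact: cvg_cst.
- rewrite -[X in _ --> X](mulr0 m%:R); apply: cvgMl_tmp; exact: cvg_harmonic.
Unshelve. all: by end_near. Qed.

Lemma ln_le_harmonic N : ln N.+1%:R <= H N.
Proof.
elim: N => [|N IH]; first by rewrite ln1 harmonic_sum0.
rewrite harmonic_sumS -lerBlDl; have := lnS_natD_le N 1; rewrite addn1 mul1r => h.
by apply: le_trans h; rewrite lerD2l lerN2.
Qed.

Lemma harmonic_sub_ln_nincr N : H N.+2 - ln N.+2%:R <= H N.+1 - ln N.+1%:R.
Proof.
have N2 : (0 : R) < N.+2%:R by rewrite ltr0n.
rewrite (harmonic_sumS R N.+1).
suff : ln N.+1%:R - ln N.+2%:R <= - N.+2%:R^-1 :> R.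
  by move: (ln _) (ln _) (_ ^-1) (H _) => ????; lra.
rewrite -ln_div ?posrE ?ltr0n //.
have -> : N.+1%:R / N.+2%:R = 1 + - N.+2%:R^-1 :> R.
  by rewrite -[N.+1%:R](addrK 1) natr1 mulrBl divff ?gt_eqF // mul1r.
apply: le_ln1Dx; rewrite ltrN2 invf_lt1 ?ltr1n //.
Qed.

(** The sequence H_N - ln N decreases and is bounded below by 0, both because
    ln (1 + x) <= x. *)
Lemma cvg_euler_gamma : (fun N => H N - ln N%:R) @ \oo --> euler_gamma R.
Proof.
suff : cvgn (fun N => H N - ln N%:R) by [].
suff /cvg_ex[l hl] : cvgn (fun N => H N.+1 - ln N.+1%:R).
  by apply/cvg_ex; exists l; rewrite -cvg_shiftS.
apply: nonincreasing_is_cvgn.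
  by apply/nonincreasing_seqP => N; exact: harmonic_sub_ln_nincr.
exists 0 => _ [N _ <-]; rewrite subr_ge0; apply: le_trans (ln_le_harmonic N) _.
by rewrite harmonic_sumS lerDl invr_ge0.
Qed.

(** This is the logarithm of N!. *)
Definition log_sum N : R := \sum_(1 <= k < N.+1) ln k%:R.

Lemma log_sumD N m : log_sum (N + m) =
  log_sum N + \sum_(1 <= k < m.+1) ln (N + k)%:R.
Proof.
elim: m => [|m IH]; first by rewrite addn0 [X in _ + X]big_geq ?addr0.
rewrite [in RHS]big_nat_recr //= addrA -IH addnS.
by rewrite /log_sum [LHS]big_nat_recr.
Qed.

Lemma harmonic_sumD N m : H (N + m) = H N + \sum_(0 <= k < m) (N + k.+1)%:R^-1.
Proof.
elim: m => [|m IH]; first by rewrite addn0 big_geq ?addr0.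
by rewrite big_nat_recr //= addrA -IH addnS harmonic_sumS.
Qed.

(** The antiderivative of the square of [beta_sum] that vanishes at infinity. *)
Definition pf_prim n s : R :=
  \sum_(i < n.+1) (c n i * ln (s + i%:R) - b n i ^+ 2 / (s + i%:R)).

(** The rational part of the double integral; its denominator divides
    lcm(1, ..., 2n). *)
Definition sondow_A n : R := \sum_(i < n.+1) b n i ^+ 2 * H (n + i).

(** The logarithmic part of the double integral; lcm(1, ..., 2n) times it is the
    logarithm of the integer S_n. *)
Definition sondow_L n : R :=
  \sum_(1 <= k < n.+1) ln (n + k)%:R * \sum_(k <= i < n.+1) c n i.

Lemma sondow_L_exchange n :
  \sum_(i < n.+1) c n i * \sum_(1 <= k < i.+1) ln (n + k)%:R = sondow_L n.
Proof.
rewrite -(big_mkord xpredT (fun i => c n i * \sum_(1 <= k < i.+1) ln (n + k)%:R)).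
transitivity (\sum_(0 <= i < n.+1) \sum_(1 <= k < n.+1 | (k <= i)%N)
                 c n i * ln (n + k)%:R).
  apply: eq_big_nat => i /= lt_in; rewrite mulr_sumr.
  by rewrite (big_nat_widen _ i.+1 n.+1).
rewrite (exchange_big_dep_nat xpredT) //=; apply: eq_big_nat => k /= _.
rewrite mulr_sumr (big_nat_widenl k 0) //=; apply: eq_bigr => i _.
by rewrite mulrC.
Qed.

(** The sums of 1 / (k + i) and ln (k + i) over k telescope to differences of
    harmonic numbers and of [log_sum]. All are recentred at n + M; the leftover
    multiples of the logarithm of (n + M)! and of ln (n + M) vanish by
    [sum_log_coef] and [sum_log_coef_index]. *)
Lemma sum_pf_prim n M : (0 < n)%N ->
  \sum_(0 <= k < M) - pf_prim n (n.+1 + k)%:R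
  = \sum_(i < n.+1) b n i ^+ 2 * (H (n + M + i) - ln (n + M)%:R)
    - \sum_(i < n.+1) c n i * \sum_(1 <= m < i.+1) (ln (n + M + m)%:R - ln (n + M)%:R)
    + (sondow_L n - sondow_A n).
Proof.
move=> n0.
transitivity (\sum_(i < n.+1) (b n i ^+ 2 * (H (n + M + i) - H (n + i))
   - c n i * (log_sum (n + M + i) - log_sum (n + i)))).
  rewrite /pf_prim; under eq_bigr => k _ do rewrite -sumrN.
  rewrite exchange_big /=; apply: eq_bigr => i _.
  rewrite (addnAC n M i) harmonic_sumD log_sumD.
  rewrite [X in _ = _ * X - _]addrC addKr [X in _ = _ - _ * X]addrC addKr.
  rewrite big_add1 /= !mulr_sumr -sumrB; apply: eq_bigr => k _.
  by rewrite opprB -natrD; congr (_ / _%:R - _ * ln _%:R); lia.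
under eq_bigr => i _.
  rewrite (log_sumD (n + M) i) (log_sumD n i).
  rewrite (_ : \sum_(1 <= k < i.+1) ln (n + M + k)%:R
     = \sum_(1 <= m < i.+1) (ln (n + M + m)%:R - ln (n + M)%:R) + i%:R * ln (n + M)%:R);
    last first.
    by rewrite sumrB sumr_const_nat subn1 /= mulr_natl subrK.
  over.
rewrite -sondow_L_exchange /sondow_A.
have := sum_log_coef_index R n n0; have := sum_log_coef R n.
set X := log_sum (n + M) - log_sum n; set Y := ln (n + M)%:R.
move=> E1 E2.
transitivity (\sum_(i < n.+1) (b n i ^+ 2 * (H (n + M + i) - Y)
  - c n i * \sum_(1 <= m < i.+1) (ln (n + M + m)%:R - Y)
  + (c n i * \sum_(1 <= k < i.+1) ln (n + k)%:R - b n i ^+ 2 * H (n + i))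
  - c n i * X + (b n i ^+ 2 * Y - i%:R * c n i * Y))).
  apply: eq_bigr => i _; rewrite /X; ring.
rewrite big_split /= [X in _ + X]sumrB -!mulr_suml E2 subrr addr0.
by rewrite sumrB -mulr_suml E1 mul0r subr0 big_split /= !sumrB.
Qed.

Lemma cvg_sum_pf_prim n : (0 < n)%N ->
  (fun M => \sum_(0 <= k < M) - pf_prim n (n.+1 + k)%:R) @ \oo
  --> (\sum_(i < n.+1) b n i ^+ 2) * euler_gamma R + (sondow_L n - sondow_A n).
Proof.
move=> n0; under eq_fun => M do rewrite sum_pf_prim // [(n + M)%N]addnC.
apply: cvgD; last exact: cvg_cst.
pose G N := \sum_(i < n.+1) b n i ^+ 2 * (H (N + i) - ln N%:R)
  - \sum_(i < n.+1) c n i * \sum_(1 <= m < i.+1) (ln (N + m)%:R - ln N%:R).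
suff : G @ \oo --> (\sum_(i < n.+1) b n i ^+ 2) * euler_gamma R.
  by rewrite -(cvg_shiftn n).
rewrite -[X in _ --> X]subr0; apply: cvgB.
  rewrite mulr_suml; apply: cvg_sumr => i _; apply: cvgMl_tmp.
  rewrite (_ : (fun N => _) = (fun N => (H (N + i) - ln (N + i)%:R)
      + (ln (N + i)%:R - ln N%:R))); last first.
    by apply/funext => N; rewrite subrKA.
  rewrite -[X in _ --> X]addr0; apply: cvgD; last exact: cvg_ln_natD.
  by have := cvg_euler_gamma; rewrite -(cvg_shiftn i).
rewrite [X in _ --> X](_ : _ = \sum_(i < n.+1) c n i * \sum_(1 <= m < i.+1) (0 : R)).
  apply: cvg_sumr => i _; apply: cvgMl_tmp; apply: cvg_sumr => m _.
  exact: cvg_ln_natD.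
by rewrite big1 // => i _; rewrite big1 ?mulr0.
Qed.

Lemma ln_prod_nat m n (F : nat -> nat) :
  (forall i, (m <= i < n)%N -> (0 < F i)%N) ->
  ln (\prod_(m <= i < n) F i)%N%:R = \sum_(m <= i < n) ln (F i)%:R :> R.
Proof.
move=> F0; rewrite big_nat_cond [in RHS]big_nat_cond.
have : (0 < \prod_(m <= i < n | (m <= i < n)%N && true) F i)%N /\
  ln (\prod_(m <= i < n | (m <= i < n)%N && true) F i)%N%:R
   = \sum_(m <= i < n | (m <= i < n)%N && true) ln (F i)%:R :> R.
  apply: (big_ind2 (fun (x : nat) (y : R) => (0 < x)%N /\ ln x%:R = y)).
  - by rewrite ln1.
  - move=> x1 x2 y1 y2 [h1 <-] [h2 <-]; rewrite muln_gt0 h1 h2; split => //.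
    by rewrite natrM lnM // posrE ltr0n.
  - by move=> i /andP[/F0].
by case.
Qed.

(** The exponents of S_n are, up to the factor lcm(1, ..., 2n), the terms of the
    double sum of [sum_log_coef_tail]. *)
Lemma ln_S_prod n : (0 < n)%N ->
  ln (S_prod n)%:R = (lcm_upto (2 * n))%:R * sondow_L n.
Proof.
move=> n0; have np k i j : (0 < (n + k) ^ ((2 * lcm_upto (2 * n)) %/ j * 'C(n, i) ^ 2))%N.
  by rewrite expn_gt0 addn_gt0 n0.
rewrite ln_prod_nat; last first.
  by move=> k _; rewrite prodn_gt0 // => i; rewrite prodn_gt0 // => j; exact: np.
rewrite mulr_sumr; apply: eq_big_nat => k /andP[k1 kn].
rewrite ln_prod_nat; last by move=> i _; rewrite prodn_gt0 // => j; exact: np.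
rewrite sum_log_coef_tail ?k1 // !mulr_sumr; apply: eq_big_nat => i /andP[_ im].
rewrite ln_prod_nat // !mulr_sumr; apply: eq_big_nat => j /andP[ij jn].
rewrite natrX lnXn ?ltr0n ?addn_gt0 ?n0 //.
rewrite -[LHS]mulr_natl natrM natrX.
have j0 : j%:R != 0 :> R by rewrite pnatr_eq0; lia.
have -> : (2 * lcm_upto (2 * n) %/ j)%N%:R = 2 * (lcm_upto (2 * n))%:R / j%:R :> R.
  apply: (mulIf j0); rewrite divfK // -[LHS]natrM divnK ?natrM //.
  by apply/dvdn_mull/dvdn_lcm_upto; lia.
ring.
Qed.

End Gamma.

(** * Iterated integrals and series of integrals *)

Section Tonelli.
Variable R : realType.
Local Notation mu := (@lebesgue_measure R).
Local Open Scope ereal_scope.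

(** Tonelli's theorem on a rectangle, together with the measurability of the inner
    integral: apply the theorem on the whole plane to the extension by 0. *)
Lemma tonelli_set (A B : set R) (f : R -> R -> \bar R) :
  measurable A -> measurable B ->
  measurable_fun (A `*` B) (fun z => f z.1 z.2) ->
  (forall x y, A x -> B y -> 0 <= f x y) ->
  measurable_fun A (fun x => \int[mu]_(y in B) f x y) /\
  \int[mu]_(x in A) \int[mu]_(y in B) f x y
    = \int[mu]_(y in B) \int[mu]_(x in A) f x y.
Proof.
move=> mA mB mf f0; pose g := (fun z => f z.1 z.2) \_ (A `*` B).
have mg : measurable_fun setT g.
  by apply/(measurable_restrictT _ _).1 => //; exact: measurableX.
have g0 z : 0 <= g z.
  rewrite /g patchE; case: ifPn => // /set_mem[Az Bz]; exact: f0.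
have gF x : \int[mu]_y g (x, y) = ((fun x => \int[mu]_(y in B) f x y) \_ A) x.
  rewrite patchE; case: ifPn => xA.
    rewrite [RHS]integral_mkcond; apply: eq_integral => y _.
    by rewrite /g !patchE in_setX /= xA.
  by rewrite integral0_eq // => y _; rewrite /g patchE in_setX /= (negbTE xA).
have gG y : \int[mu]_x g (x, y) = ((fun y => \int[mu]_(x in A) f x y) \_ B) y.
  rewrite patchE; case: ifPn => yB.
    rewrite [RHS]integral_mkcond; apply: eq_integral => x _.
    by rewrite /g !patchE in_setX /= yB andbT.
  by rewrite integral0_eq // => x _; rewrite /g patchE in_setX /= (negbTE yB) andbF.
split.
  apply/measurable_restrictT => //; rewrite -(funext gF).
  have := (@measurable_fun_fubini_tonelli_F _ _ _ _ _ mu _ mg g0).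
  by rewrite /fubini_F.
rewrite [LHS]integral_mkcond [RHS]integral_mkcond -(funext gF) -(funext gG).
exact: (fubini_tonelli (m1 := mu) (m2 := mu) _ mg g0).
Qed.

End Tonelli.

Section Weight.
Variable R : realType.
Local Notation mu := (@lebesgue_measure R).
Local Open Scope ereal_scope.

Lemma nneseries_EFin (a : nat -> R) (l : R) :
  (fun N => \sum_(0 <= k < N) a k)%R @ \oo --> l ->
  \sum_(0 <= k <oo) (a k)%:E = l%:E.
Proof.
move=> al; apply: cvg_lim => //.
under eq_fun => N do rewrite sumEFin.
by apply: cvg_EFin => //; exact: nearW.
Qed.

(** For t >= 0 this is floor(t) + 1. Written as a sum of indicators, it turns an
    integral on the half-line into the series of the integrals over [k, +oo[, so
    that a single integral represents a series of integrals. *)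
Definition floor_weight (t : R) : \bar R :=
  \sum_(0 <= k <oo) (\1_(`[k%:R, +oo[%classic : set R) t)%:E.

Lemma floor_weight_ge0 t : 0 <= floor_weight t.
Proof. by apply: nneseries_ge0 => k _ _; rewrite lee_fin. Qed.

Lemma measurable_floor_weight D : measurable_fun D floor_weight.
Proof.
apply: measurable_funTS; apply: ge0_emeasurable_sum => [k x _ _|k _].
  by rewrite lee_fin.
by apply/measurable_EFinP; apply: measurable_indic; exact: measurable_itv.
Qed.

Lemma integral_floor_weight (g : R -> R) :
  measurable_fun (`[0%R, +oo[%classic : set R) g -> (forall t, (0 <= t)%R -> (0 <= g t)%R) ->
  \int[mu]_(t in `[0%R, +oo[) (floor_weight t * (g t)%:E)
  = \sum_(0 <= k <oo) \int[mu]_(t in `[k%:R, +oo[) (g t)%:E.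
Proof.
move=> mg g0; transitivity (\int[mu]_(t in `[0%R, +oo[)
   \sum_(0 <= k <oo) ((g t)%:E * (\1_(`[k%:R, +oo[%classic : set R) t)%:E)).
  apply: eq_integral => t _; rewrite muleC -nneseriesZl //.
transitivity (\sum_(0 <= k <oo) \int[mu]_(t in `[0%R, +oo[)
   ((g t)%:E * (\1_(`[k%:R, +oo[%classic : set R) t)%:E)); last first.
- apply: eq_eseriesr => k _.
  have E : `[0%R, +oo[ `&` `[k%:R, +oo[ = `[k%:R, +oo[%classic :> set R.
    apply/seteqP; split => s /=; first by case.
    by rewrite !in_itv /= !andbT => kt; split => //; exact: le_trans (ler0n _ _) kt.
  rewrite -[X in _ = integral _ X _]E integral_mkcondr.
  by apply: eq_integral => s _; rewrite epatch_indic.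
apply: integral_nneseries => //.
- move=> k; apply: emeasurable_funM; first by apply/measurable_EFinP; exact: mg.
  by apply/measurable_EFinP; apply: measurable_indic; exact: measurable_itv.
- move=> k t; rewrite /= in_itv /= andbT => t0.
  by rewrite -EFinM lee_fin mulr_ge0 ?g0.
Qed.

End Weight.

(** * Antiderivatives on a half-line *)

Section Calculus.
Variable R : realType.
Implicit Types (n i k : nat) (s t a : R).
Local Notation mu := (@lebesgue_measure R).
Local Notation b n i := ('C(n, i)%:R : R).

Lemma is_derive_continuous (F : R -> R) (x df : R) :
  is_derive x 1 F df -> {for x, continuous F}.
Proof.
by move=> dF; apply/differentiable_continuous/derivable1_diffP; exact: ex_derive.
Qed.

Lemma integral_itvcy_prim (f F : R -> R) a (l : R) :
  (forall x, a <= x -> 0 <= f x) ->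
  (forall x, a <= x -> {for x, continuous f}) ->
  (forall x, a <= x -> is_derive x 1 F (f x)) ->
  F x @[x --> +oo] --> l ->
  (\int[mu]_(x in `[a, +oo[) (f x)%:E = (l - F a)%:E)%E.
Proof.
move=> f0 fc dF Fl.
have Fc x : a <= x -> {for x, continuous F} by move=> /dF /is_derive_continuous.
rewrite (ge0_continuous_FTC2y f0 _ Fl) //.
- apply/continuous_within_itvcyP; split.
    by move=> x; rewrite in_itv /= andbT => /ltW /fc.
  by apply: cvg_at_right_filter; exact: fc.
- by move=> x /ltW /dF dFx; exact: ex_derive.
- by apply: cvg_at_right_filter; exact: Fc.
- move=> x; rewrite in_itv /= andbT => /ltW /dF dFx.
  by rewrite derive1E; exact: derive_val.
Qed.

Lemma is_derive_sum_fun n (h : 'I_n -> R -> R) (x : R) (dh : 'I_n -> R) :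
  (forall j, is_derive x 1 (h j) (dh j)) ->
  is_derive x 1 (fun y => \sum_(j < n) h j y) (\sum_(j < n) dh j).
Proof.
move=> hd; rewrite (_ : (fun y => _) = \sum_(j < n) h j).
  exact: is_derive_sum.
by apply/funext => y; rewrite fct_sumE.
Qed.

Lemma is_derive_addr (x a : R) : is_derive x 1 (fun y : R => y + a) 1.
Proof. by have := is_derive_shift x 1 a. Qed.

Lemma is_derive_addl (x a : R) : is_derive x 1 (fun y : R => a + y) 1.
Proof.
rewrite (_ : (fun y => _) = fun y => y + a); first exact: is_derive_addr.
by apply/funext => y; rewrite addrC.
Qed.

Lemma is_derive_ln_addr (x a : R) : 0 < x + a ->
  is_derive x 1 (fun y : R => ln (y + a)) (x + a)^-1.
Proof.
move=> xa; rewrite -[(x + a)^-1]mulr1.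
exact: (@is_derive1_comp R (@ln R) (fun y => y + a) x _ _ (is_derive1_ln xa) (is_derive_addr x a)).
Qed.

Lemma is_derive_inv_addr (x a : R) : 0 < x + a ->
  is_derive x 1 (fun y : R => (y + a)^-1) (- (x + a) ^- 2).
Proof.
move=> xa; have xa0 : x + a != 0 by rewrite gt_eqF.
have := @is_deriveV _ (fun y => y + a) x 1 1 xa0 (is_derive_addr x a).
by rewrite /GRing.scale /= mulr1.
Qed.

Lemma is_derive_pf_prim n s : 0 < s ->
  is_derive s 1 (pf_prim R n) (beta_sum R n s ^+ 2).
Proof.
move=> s0; rewrite beta_sum_sq //; apply: is_derive_sum_fun => i.
have si : 0 < s + i%:R by rewrite ltr_pwDl.
have d1 := is_deriveZ (log_coef R n i) (is_derive_ln_addr s i%:R si).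
have d2 := is_deriveZ (b n i ^+ 2) (is_derive_inv_addr s i%:R si).
apply: is_derive_eq (is_deriveB d1 d2) _.
by rewrite /GRing.scale /= mulrN opprK addrC.
Qed.

Lemma continuous_beta_sum n s : 0 < s -> {for s, continuous (beta_sum R n)}.
Proof.
move=> s0; apply: (@is_derive_continuous _ _
  (\sum_(i < n.+1) (-1) ^+ i * b n i * - (s + i%:R) ^- 2)).
apply: is_derive_sum_fun => i; have si : 0 < s + i%:R by rewrite ltr_pwDl.
exact: (is_deriveZ ((-1) ^+ i * b n i) (is_derive_inv_addr s i%:R si)).
Qed.

Lemma cvg_inv_pinfty : x^-1 @[x --> +oo] --> (0 : R).
Proof.
by apply/gtr0_cvgV0; [exact: nbhs_pinfty_gt|exact: cvg_id].
Qed.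

Lemma cvg_addr_pinfty a : (fun s => s + a) @ +oo --> +oo.
Proof.
apply/cvgryPge => A; near=> s; rewrite -lerBlDr; near: s.
by apply: nbhs_pinfty_ge; exact: num_real.
Unshelve. all: by end_near. Qed.

(** As the coefficients of the logarithms add up to 0, each ln (s + i) may be
    replaced by ln (s + i) - ln s, which tends to 0. *)
Lemma cvg_pf_prim n : pf_prim R n s @[s --> +oo] --> (0 : R).
Proof.
have lnD i : ln (s + i%:R) - ln s @[s --> +oo] --> (0 : R).
  apply: (@squeeze_cvgr _ _ _ _ (fun=> 0) (fun s => i%:R * s^-1)).
  - near=> s.
    have s0 : 0 < s by near: s; exact: nbhs_pinfty_gt.
    have si : 0 < s + i%:R by rewrite ltr_pwDl.
    rewrite subr_ge0 ler_ln ?posrE // lerDl ler0n /=.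
    rewrite -ln_div ?posrE // mulrDl divff ?gt_eqF //.
    by apply: le_ln1Dx; apply: lt_le_trans (_ : 0 <= _) => //; rewrite divr_ge0 // ltW.
  - exact: cvg_cst.
  - by rewrite -[X in _ --> X](mulr0 i%:R); apply: cvgMl_tmp; exact: cvg_inv_pinfty.
have invD i : (s + i%:R)^-1 @[s --> +oo] --> (0 : R).
  apply/gtr0_cvgV0; last exact: cvg_addr_pinfty.
  near=> s; rewrite ltr_pwDl //; near: s; exact: nbhs_pinfty_gt.
have -> : pf_prim R n = fun s => \sum_(i < n.+1)
    (log_coef R n i * (ln (s + i%:R) - ln s) - b n i ^+ 2 * (s + i%:R)^-1).
  apply/funext => s; rewrite /pf_prim.
  transitivity (\sum_(i < n.+1) (log_coef R n i * ln (s + i%:R) - b n i ^+ 2 / (s + i%:R))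
    - (\sum_(i < n.+1) log_coef R n i) * ln s).
    by rewrite sum_log_coef mul0r subr0.
  by rewrite mulr_suml -sumrB; apply: eq_bigr => i _; ring.
rewrite [X in _ --> X](_ : _ = \sum_(i < n.+1) (0 : R)); last by rewrite big1.
apply: cvg_big => [|i _]; first exact: add_continuous.
rewrite -[X in _ --> X]subr0 -[X in _ --> X - _](mulr0 (log_coef R n i)).
rewrite -[X in _ --> _ - X](mulr0 (b n i ^+ 2)).
by apply: cvgB; apply: cvgMl_tmp.
Unshelve. all: by end_near. Qed.

(** Since [pf_prim] vanishes at infinity, only its value at the lower bound
    remains. *)
Lemma integral_beta_sum_sq n k :
  (\int[mu]_(t in `[k%:R, +oo[) (beta_sum R n (n.+1%:R + t) ^+ 2)%:E
   = (- pf_prim R n (n.+1 + k)%:R)%:E)%E.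
Proof.
have pos t : k%:R <= t -> 0 < n.+1%:R + t.
  by move=> kt; rewrite ltr_pwDl // (le_trans _ kt).
transitivity ((0 - pf_prim R n (n.+1%:R + k%:R))%:E); last by rewrite sub0r natrD.
apply: (integral_itvcy_prim _ (fun t => pf_prim R n (n.+1%:R + t))).
- by move=> x _; exact: sqr_ge0.
- move=> x /pos x0.
  apply: (@continuous_comp _ _ _ (fun t => beta_sum R n (n.+1%:R + t))
    (fun y : R => y ^+ 2)); last exact: exprn_continuous.
  apply: (@continuous_comp _ _ _ (fun t => n.+1%:R + t) (beta_sum R n));
    last exact: continuous_beta_sum.
  by apply: continuousD; [exact: cst_continuous|exact: cvg_id].
- move=> x /pos x0; rewrite -[X in is_derive _ _ _ X]mulr1.
  exact: (@is_derive1_comp R (pf_prim R n) (fun t => n.+1%:R + t) x _ _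
    (is_derive_pf_prim n (n.+1%:R + x) x0) (is_derive_addl x _)).
- apply: (@cvg_comp _ _ _ (fun t => n.+1%:R + t) (pf_prim R n)); last exact: cvg_pf_prim.
  by under eq_fun do rewrite addrC; exact: cvg_addr_pinfty.
Qed.

Lemma integral_expR_itvcy (l : R) k : l < 0 ->
  (\int[mu]_(t in `[k%:R, +oo[) (expR (t * l))%:E = (expR l ^+ k / - l)%:E)%E.
Proof.
move=> l0.
have dF (x : R) : is_derive x 1 (fun t : R => expR (t * l) / l) (expR (x * l)).
  have d1 : is_derive x 1 (fun t : R => t * l) l.
    have := is_deriveZ l (is_derive_id (x : R) (1 : R)).
    rewrite /GRing.scale /= mulr1; congr (is_derive _ _ _ _).
    by apply/funext => t; exact: mulrC.
  have d2 := @is_derive1_comp R (@expR R) (fun t => t * l) x _ _ (is_derive_expR (x * l)) d1.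
  have := is_deriveZ l^-1 d2; rewrite /GRing.scale /= mulrCA mulVf ?lt_eqF // mulr1.
  by congr (is_derive _ _ _ _); apply/funext => t; exact: mulrC.
transitivity ((0 - expR (k%:R * l) / l)%:E); last first.
  by rewrite sub0r expRM_natl invrN mulrN.
apply: (integral_itvcy_prim _ (fun t => expR (t * l) / l)).
- by move=> x _; exact: expR_ge0.
- move=> x _; apply: (@continuous_comp _ _ _ (fun t => t * l) (@expR R));
    last exact: continuous_expR.
  by apply: continuousM; [exact: cvg_id|exact: cst_continuous].
- rewrite -[X in _ --> X](mul0r l^-1); apply: cvgMr_tmp.
  rewrite (_ : (fun t => _) = (fun z => expR (- z)) \o (fun t => t * - l)); last first.
    by apply/funext => t /=; rewrite mulrN opprK.
  apply: (@cvg_comp _ _ _ _ _ _ (pinfty_nbhs R)); last exact: cvgr_expR.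
  by apply: gt0_cvgMly; [rewrite oppr_gt0|exact: cvg_id].
Qed.

End Calculus.

(** * The beta integral with a real exponent *)

Section BetaIntegral.
Variable R : realType.
Implicit Types (n i k : nat) (t x y : R).
Local Notation mu := (@lebesgue_measure R).
Local Notation b n i := ('C(n, i)%:R : R).

(** Linear combinations of real powers, treated at once so that the fundamental
    theorem of calculus is applied a single time. *)
Definition powR_comb n (c a : nat -> R) x : R := \sum_(i < n.+1) c i * x `^ a i.

Lemma is_derive_powR_comb n (c a : nat -> R) x : 0 < x ->
  is_derive x 1 (powR_comb n c a) (\sum_(i < n.+1) c i * (a i * x `^ (a i - 1))).
Proof.
move=> x0; apply: is_derive_sum_fun => i.
exact: (is_deriveZ (c i) (is_derive1_powR (a i) x0)).
Qed.

Lemma powR_comb0 n (c a : nat -> R) : (forall i, 0 < a i) -> powR_comb n c a 0 = 0.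
Proof. by move=> a0; apply: big1 => i _; rewrite powR0 ?mulr0 // gt_eqF. Qed.

(** Real powers of negative numbers are 1 by convention, so at 0 there is only a
    limit from the right, and it is the value at 0 because the exponents are
    positive. *)
Lemma cvg_powR_comb0 n (c a : nat -> R) : (forall i, 0 < a i) ->
  powR_comb n c a x @[x --> 0^'+] --> powR_comb n c a 0.
Proof.
move=> a0; rewrite powR_comb0 //.
rewrite [X in _ --> X](_ : _ = \sum_(i < n.+1) (0 : R)); last by rewrite big1.
apply: cvg_big => [|i _]; first exact: add_continuous.
by rewrite -[X in _ --> X](mulr0 (c i)); apply: cvgMl_tmp; exact: powR_cvg0.
Qed.

Lemma powR_comb_within n (c a : nat -> R) : (forall i, 0 < a i) ->
  {in `]0, 1[, continuous (powR_comb n c a)} /\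
  powR_comb n c a x @[x --> 1^'-] --> powR_comb n c a 1.
Proof.
move=> a0; have ct x : 0 < x -> {for x, continuous (powR_comb n c a)}.
  by move=> x0; exact: is_derive_continuous (is_derive_powR_comb n c a x x0).
split; first by move=> x; rewrite in_itv /= => /andP[/ct].
by apply: cvg_at_left_filter; apply: ct.
Qed.

Lemma integral_powR_comb n (c a : nat -> R) : (forall i, 0 < a i) ->
  (\int[mu]_(x in `[0%R, 1%R]) (powR_comb n c a x)%:E
   = (\sum_(i < n.+1) c i / (a i + 1))%:E)%E.
Proof.
move=> a0; pose c' i := c i / (a i + 1); pose a' i := a i + 1.
have a'0 i : 0 < a' i by rewrite addr_gt0.
have [fc f1] := powR_comb_within n c a a0.
have [Fc F1] := powR_comb_within n c' a' a'0.
rewrite (@continuous_FTC2 _ _ (powR_comb n c' a')) ?ltr01 //.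
- rewrite powR_comb0 // sube0; congr (_%:E); apply: eq_bigr => i _.
  by rewrite powR1 mulr1.
- apply/continuous_within_itvP => //; split => //; exact: cvg_powR_comb0.
- split => //; last exact: cvg_powR_comb0.
  move=> x; rewrite in_itv /= => /andP[x0 _].
  have dF := is_derive_powR_comb n c' a' x x0; exact: ex_derive.
- move=> x; rewrite in_itv /= => /andP[x0 _].
  have dF := is_derive_powR_comb n c' a' x x0.
  rewrite derive1E derive_val; apply: eq_bigr => i _.
  by rewrite /c' /a' addrK mulrA divfK // gt_eqF // a'0.
Qed.

(** For x > 0 this is (x (1 - x))^n x^t. The exponential form makes the kernel
    visibly jointly measurable, and at x = 0 the first factor annihilates the
    meaningless value of ln. *)
Definition beta_kernel n x t : R := (x * (1 - x)) ^+ n * expR (t * ln x).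

Lemma beta_kernel_ge0 n x t : 0 <= x <= 1 -> 0 <= beta_kernel n x t.
Proof.
case/andP=> x0 x1; rewrite mulr_ge0 ?expR_ge0 // exprn_ge0 // mulr_ge0 //.
by rewrite subr_ge0.
Qed.

Lemma beta_kernelE n x t : (0 < n)%N -> 0 <= x -> 0 <= t ->
  beta_kernel n x t
  = powR_comb n (fun i => (-1) ^+ i * b n i) (fun i => n%:R + i%:R + t) x.
Proof.
move=> n0; rewrite le_eqVlt => /predU1P[<-|x0] t0.
  rewrite powR_comb0 => [|i]; last by rewrite ltr_pwDl // ltr_pwDl // ltr0n.
  by rewrite /beta_kernel mul0r expr0n; case: n n0 => // n _; rewrite mul0r.
rewrite /beta_kernel exprMn exprBn mulr_sumr mulr_suml; apply: eq_bigr => i _.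
rewrite !powRD ?(gt_eqF x0) ?implybT // !powR_mulrn ?(ltW x0) //.
by rewrite expr1n mulr1 -mulr_natr /powR (gt_eqF x0); ring.
Qed.

Lemma integral_beta_kernel n t : (0 < n)%N -> 0 <= t ->
  (\int[mu]_(x in `[0%R, 1%R]) (beta_kernel n x t)%:E
   = (beta_sum R n (n.+1%:R + t))%:E)%E.
Proof.
move=> n0 t0.
transitivity (\int[mu]_(x in `[0%R, 1%R]) (powR_comb n (fun i => (-1) ^+ i * b n i)
   (fun i => n%:R + i%:R + t) x)%:E)%E.
  apply: eq_integral => x; rewrite inE /= in_itv /= => /andP[x0 _].
  by rewrite beta_kernelE.
rewrite integral_powR_comb => [|i]; last by rewrite ltr_pwDl // ltr_pwDl // ltr0n.
congr (_%:E); apply: eq_bigr => i _; congr (_ / _).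
by rewrite -natr1; ring.
Qed.

End BetaIntegral.

(** * The double integral *)

Section SondowIntegral.
Variable R : realType.
Implicit Types (n i k : nat) (t x y : R).
Local Notation mu := (@lebesgue_measure R).
Local Notation b n i := ('C(n, i)%:R : R).

Let itv01 : set R := `[0, 1].
Let itv0y : set R := `[0, +oo[.

Let m01 : measurable itv01.
Proof. exact: measurable_itv. Qed.

Let m0y : measurable itv0y.
Proof. exact: measurable_itv. Qed.

Lemma measurable_beta_kernel n : measurable_fun setT (fun z : R * R => beta_kernel R n z.1 z.2).
Proof.
apply: measurable_funM.
  apply: measurable_funX; apply: measurable_funM => //.
  by apply: measurable_funB => //; exact: measurable_cst.
apply: (measurableT_comp (@measurable_expR R)); apply: measurable_funM => //.
by apply: (measurableT_comp (@measurable_ln R)).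
Qed.

Lemma measurable_beta_kernel_l n t : measurable_fun setT (fun x => beta_kernel R n x t).
Proof.
apply: measurable_funM.
  by apply: measurable_funX; apply: measurable_funM => //; exact: measurable_funB.
by apply: (measurableT_comp (@measurable_expR R)); exact: measurable_funM.
Qed.

Lemma measurable_beta_kernel_r n x : measurable_fun setT (beta_kernel R n x).
Proof.
apply: measurable_funM; first exact: measurable_cst.
by apply: (measurableT_comp (@measurable_expR R)); exact: measurable_funM.
Qed.

(** Integrating x out of the kernel replaces it by [beta_sum]. Used twice: with
    g the kernel in the other variable, then with g the [beta_sum] that the first
    use produced. *)
Lemma tonelli_kernel n (g : R -> R) : (0 < n)%N ->
  measurable_fun itv0y g -> (forall t, 0 <= t -> 0 <= g t) ->
  (measurable_fun itv01 (fun x => \int[mu]_(t in itv0y)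
     (floor_weight R t * (beta_kernel R n x t * g t)%:E)) /\
   \int[mu]_(x in itv01) \int[mu]_(t in itv0y)
     (floor_weight R t * (beta_kernel R n x t * g t)%:E)
   = \int[mu]_(t in itv0y)
     (floor_weight R t * (beta_sum R n (n.+1%:R + t) * g t)%:E))%E.
Proof.
move=> n0 mg g0.
have w0 t : itv0y t -> 0 <= g t by rewrite /itv0y /= in_itv /= andbT => /g0.
have k0 x t : itv01 x -> 0 <= beta_kernel R n x t.
  by rewrite /itv01 /= in_itv /= => /beta_kernel_ge0.
have [||m1 ->] := @tonelli_set R itv01 itv0y
  (fun x t => floor_weight R t * (beta_kernel R n x t * g t)%:E)%E m01 m0y.
- apply: emeasurable_funM.
    apply: (measurableT_comp (@measurable_floor_weight R setT)).
    by apply: measurable_funTS; exact: measurable_snd.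
  apply/measurable_EFinP; apply: measurable_funM.
    exact: measurable_funTS (measurable_beta_kernel n).
  apply: (measurable_comp m0y _ mg);
    last by apply: measurable_funTS; exact: measurable_snd.
  by move=> _ [z [_ z2] <-].
- move=> x t x01 t0; rewrite mule_ge0 ?floor_weight_ge0 //.
  by rewrite lee_fin mulr_ge0 ?k0 ?w0.
split => //; apply: eq_integral => t; rewrite inE => t0.
have t_ge0 : 0 <= t by move: t0; rewrite /itv0y /= in_itv /= andbT.
have mk : measurable_fun itv01 (fun x => (beta_kernel R n x t)%:E).
  by apply/measurable_EFinP; apply: measurable_funTS; exact: measurable_beta_kernel_l.
have kt0 x : itv01 x -> (0 <= (beta_kernel R n x t)%:E)%E.
  by move=> x01; rewrite lee_fin k0.
rewrite ge0_integralZl ?floor_weight_ge0 //; last 2 first.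
- apply/measurable_EFinP; apply: measurable_funM; last exact: measurable_cst.
  by apply: measurable_funTS; exact: measurable_beta_kernel_l.
- by move=> x x01; rewrite EFinM mule_ge0 ?kt0 // lee_fin w0.
congr (_ * _)%E; under eq_integral => x _ do rewrite EFinM.
by rewrite ge0_integralZr // ?lee_fin ?w0 // integral_beta_kernel.
Qed.

Definition sondow_integrand n x y : R :=
  - ((x * (1 - x) * y * (1 - y)) ^+ n / ((1 - x * y) * ln (x * y))).

(** With u = exp l in ]0, 1[, each integral over [k, +oo[ gives u^k / (- ln u), and
    the geometric series gives the factor 1 / (1 - u). *)
Lemma geometric_floor_weight (c l : R) : 0 <= c -> l < 0 ->
  (\int[mu]_(t in itv0y) (floor_weight R t * (c * expR (t * l))%:E)
   = (c / ((1 - expR l) * - l))%:E)%E.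
Proof.
move=> c0 l0.
have mexp : measurable_fun setT (fun t : R => expR (t * l)).
  apply: (measurableT_comp (@measurable_expR R)); apply: measurable_funM => //.
rewrite integral_floor_weight; last 2 first.
- by apply: measurable_funM => //; exact: measurable_funTS.
- by move=> t _; rewrite mulr_ge0 ?expR_ge0.
transitivity (\sum_(0 <= k <oo) (c / - l * expR l ^+ k)%:E)%E.
  apply: eq_eseriesr => k _; under eq_integral => t _ do rewrite EFinM.
  rewrite ge0_integralZl_EFin //.
  - by rewrite integral_expR_itvcy // -EFinM; congr (_%:E); ring.
  - by apply/measurable_EFinP; exact: measurable_funTS.
apply: nneseries_EFin.
have -> : c / ((1 - expR l) * - l) = c / - l * (1 - expR l)^-1.
  by rewrite invfM; ring.
apply: cvg_geometric_series.
by rewrite ger0_norm ?expR_ge0 // expR_lt1.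
Qed.

Lemma unit_square_interior x y : 0 <= x <= 1 -> 0 <= y <= 1 ->
  x * (1 - x) * y * (1 - y) != 0 -> (0 < x < 1) && (0 < y < 1).
Proof.
move=> /andP[x0 x1] /andP[y0 y1]; rewrite !mulf_eq0 !negb_or !subr_eq0.
move=> /andP[/andP[/andP[xn0 xn1] yn0] yn1].
by rewrite !lt_neqAle x0 x1 y0 y1 !andbT (eq_sym 0 x) (eq_sym 0 y) xn0 yn0 (eq_sym x) (eq_sym y) xn1 yn1.
Qed.

(** The factor 1 / ((1 - xy) (- ln (xy))) is the integral of (xy)^t against
    [floor_weight]; this separates the variables x and y. On the boundary of the
    square both sides are 0, because of the factor (x (1 - x) y (1 - y))^n. *)
Lemma sondow_integrandE n x y : (0 < n)%N -> 0 <= x <= 1 -> 0 <= y <= 1 ->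
  ((sondow_integrand n x y)%:E = \int[mu]_(t in itv0y)
     (floor_weight R t * (beta_kernel R n x t * beta_kernel R n y t)%:E))%E.
Proof.
move=> n0 x01 y01; set P := x * (1 - x) * y * (1 - y).
have kk t : beta_kernel R n x t * beta_kernel R n y t
    = P ^+ n * expR (t * (ln x + ln y)).
  have -> : P ^+ n = (x * (1 - x)) ^+ n * (y * (1 - y)) ^+ n by rewrite -exprMn mulrA.
  by rewrite /beta_kernel (mulrDr t) expRD; ring.
under eq_integral => t _ do rewrite kk.
have [P0|/unit_square_interior] := eqVneq P 0.
  rewrite /sondow_integrand -/P P0 expr0n; case: n n0 {kk} => // n _.
  rewrite mul0r oppr0 integral0_eq // => t _; by rewrite mul0r mule0.
case/(_ x01 y01)/andP=> /andP[x0 x1] /andP[y0 y1].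
have P0 : 0 <= P by rewrite !mulr_ge0 ?subr_ge0 ?ltW.
rewrite geometric_floor_weight ?exprn_ge0 //; last first.
  by rewrite -[X in _ < X]addr0 ltrD // ln_lt0 // ?x0 ?y0.
rewrite -lnM ?posrE // lnK ?posrE ?mulr_gt0 // /sondow_integrand -/P.
by rewrite mulrN invrN mulrN.
Qed.

Lemma sondow_integrand_ge0 n x y : (0 < n)%N -> 0 <= x <= 1 -> 0 <= y <= 1 ->
  0 <= sondow_integrand n x y.
Proof.
move=> n0 x01 y01; rewrite -lee_fin sondow_integrandE //.
apply: integral_ge0 => t _; rewrite mule_ge0 ?floor_weight_ge0 // lee_fin.
by rewrite mulr_ge0 ?beta_kernel_ge0.
Qed.

(** With u = xy and P = x (1 - x) y (1 - y): - ln u >= 1 - u and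
    (1 - u)^2 >= (1 - x) (1 - y) >= P, so the integrand is at most P^(n - 1), and
    P <= 1/16. *)
Lemma sondow_integrand_le n x y : (0 < n)%N -> 0 <= x <= 1 -> 0 <= y <= 1 ->
  sondow_integrand n x y <= 16^-1 ^+ n.-1.
Proof.
move=> n0 x01 y01; set P := x * (1 - x) * y * (1 - y).
have [P0|/unit_square_interior] := eqVneq P 0.
  rewrite /sondow_integrand -/P P0 expr0n; case: n n0 => // n _.
  by rewrite mul0r oppr0 exprn_ge0 // invr_ge0.
case/(_ x01 y01)/andP=> /andP[x0 x1] /andP[y0 y1].
have u0 : 0 < x * y by rewrite mulr_gt0.
have Ppos : 0 < P by rewrite !mulr_gt0 ?subr_gt0.
have P16 : P <= 16^-1.
  have q (z : R) : z * (1 - z) <= 4^-1 by have := sqr_ge0 (z - 2^-1); lra.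
  have -> : P = (x * (1 - x)) * (y * (1 - y)) by rewrite /P; ring.
  have -> : 16^-1 = 4^-1 * 4^-1 :> R by lra.
  by apply: ler_pM; rewrite ?q // mulr_ge0 ?subr_ge0 ?ltW.
have lnu : ln (x * y) <= x * y - 1.
  by have := @le_ln1Dx R (x * y - 1); rewrite (addrC 1) subrK; apply; lra.
have ux : x * y <= x by rewrite ler_piMr ?ltW.
have uy : x * y <= y by rewrite ler_piMl ?ltW.
have u1 : x * y <= 1 by apply: le_trans ux (ltW x1).
have den : P <= (1 - x * y) * - ln (x * y).
  apply: (@le_trans _ _ ((1 - x * y) * (1 - x * y))); last first.
    by rewrite ler_wpM2l ?subr_ge0 //; lra.
  apply: (@le_trans _ _ ((1 - x) * (1 - y))).
    have -> : P = (1 - x) * (1 - y) * (x * y) by rewrite /P; ring.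
    by rewrite ler_piMr // mulr_ge0 ?subr_ge0 ?ltW.
  by apply: ler_pM; rewrite ?subr_ge0 ?(ltW x1) ?(ltW y1) // lerD2l lerN2.
rewrite /sondow_integrand -/P -mulrN -invrN -mulrN.
case: n n0 => // n _; rewrite /= ler_pdivrMr; last exact: lt_le_trans den.
rewrite exprSr; apply: ler_pM => //; rewrite ?exprn_ge0 ?(ltW Ppos) //.
by rewrite lerXn2r ?nnegrE ?invr_ge0 ?(ltW Ppos).
Qed.

Lemma measurable_beta_sum n :
  measurable_fun itv0y (fun t => beta_sum R n (n.+1%:R + t)).
Proof.
apply: subspace_continuous_measurable_fun => //.
apply/continuous_within_itvcyP.
have ct t : 0 <= t -> {for t, continuous (fun t => beta_sum R n (n.+1%:R + t))}.
  move=> t0; apply: (@continuous_comp _ _ _ (fun t => n.+1%:R + t) (beta_sum R n)).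
    by apply: continuousD; [exact: cst_continuous|exact: cvg_id].
  by apply: continuous_beta_sum; rewrite ltr_pwDl.
split; first by move=> t; rewrite in_itv /= andbT => /ltW /ct.
by apply: cvg_at_right_filter; apply: ct.
Qed.

Lemma beta_sum_ge0 n t : (0 < n)%N -> 0 <= t -> 0 <= beta_sum R n (n.+1%:R + t).
Proof.
move=> n0 t0; rewrite -lee_fin -integral_beta_kernel //.
apply: integral_ge0 => x /=; rewrite in_itv /= lee_fin; exact: beta_kernel_ge0.
Qed.

Lemma sondow_inner n y : (0 < n)%N -> 0 <= y <= 1 ->
  (measurable_fun itv01 (fun x => (sondow_integrand n x y)%:E) /\
   \int[mu]_(x in itv01) (sondow_integrand n x y)%:E
   = \int[mu]_(t in itv0y) (floor_weight R t *
       (beta_kernel R n y t * beta_sum R n (n.+1%:R + t))%:E))%E.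
Proof.
move=> n0 y01.
have [||m1 e1] := tonelli_kernel n (beta_kernel R n y) n0.
- by apply: measurable_funTS; exact: measurable_beta_kernel_r.
- by move=> t _; exact: beta_kernel_ge0.
have E x : itv01 x -> ((sondow_integrand n x y)%:E = \int[mu]_(t in itv0y)
     (floor_weight R t * (beta_kernel R n x t * beta_kernel R n y t)%:E))%E.
  by rewrite /itv01 /= in_itv /= => x01; rewrite sondow_integrandE.
split.
  by apply: eq_measurable_fun m1 => x /set_mem /E ->.
under eq_integral => x /set_mem /E -> do over.
by rewrite e1; apply: eq_integral => t _; rewrite (mulrC (beta_sum _ _ _)).
Qed.

(** After both variables are integrated out there remains the integral of the
    square of [beta_sum] against [floor_weight], that is, a series of values of
    [pf_prim]. *)
Lemma sondow_outer n : (0 < n)%N ->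
  (measurable_fun itv01 (fun y => \int[mu]_(x in itv01) (sondow_integrand n x y)%:E) /\
   \int[mu]_(y in itv01) \int[mu]_(x in itv01) (sondow_integrand n x y)%:E
   = ((\sum_(i < n.+1) b n i ^+ 2) * euler_gamma R
       + (sondow_L R n - sondow_A R n))%:E)%E.
Proof.
move=> n0; have mb := measurable_beta_sum n.
have b0 t : 0 <= t -> 0 <= beta_sum R n (n.+1%:R + t) by exact: beta_sum_ge0.
have [m1 e1] := tonelli_kernel n _ n0 mb b0.
have E y : itv01 y -> _ := fun y01 => (sondow_inner n y n0 y01).2.
split; first by apply: eq_measurable_fun m1 => y /set_mem /E ->.
under eq_integral => y /set_mem /E -> do over.
rewrite e1 integral_floor_weight; last 2 first.
- exact: measurable_funM.
- by move=> t t0; rewrite mulr_ge0 ?b0.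
under eq_eseriesr => k _ do rewrite integral_beta_sum_sq.
by apply: nneseries_EFin; exact: cvg_sum_pf_prim.
Qed.

Lemma integral_itv01_le (f : R -> \bar R) (c : R) :
  measurable_fun itv01 f -> (forall x, 0 <= x <= 1 -> (0 <= f x <= c%:E)%E) ->
  (0 <= \int[mu]_(x in itv01) f x <= c%:E)%E.
Proof.
move=> mf fc; have fc' x : itv01 x -> (0 <= f x <= c%:E)%E.
  by rewrite /itv01 /= in_itv /= => /fc.
apply/andP; split; first by apply: integral_ge0 => x /fc' /andP[].
apply: (@le_trans _ _ (\int[mu]_(x in itv01) c%:E)%E).
  by apply: ge0_le_integral => // x /fc' /andP[].
rewrite integral_cst // /mu /= lebesgue_measure_itv /= lte_fin ltr01 oppr0 adde0.
by rewrite mule1.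
Qed.

(** The real-valued iterated integral agrees with the extended one, since the inner
    integrals are bounded by [sondow_integrand_le]. *)
Lemma I_int_sondow n : (0 < n)%N ->
  I_int R n = (\sum_(i < n.+1) b n i ^+ 2) * euler_gamma R
      + (sondow_L R n - sondow_A R n) /\
  0 <= I_int R n <= 16^-1 ^+ n.-1.
Proof.
move=> n0; have [m1 e1] := sondow_outer n n0.
have inn y : 0 <= y <= 1 ->
  (0 <= \int[mu]_(x in itv01) (sondow_integrand n x y)%:E <= (16^-1 ^+ n.-1)%:E)%E.
  move=> y01; apply: integral_itv01_le; first exact: (sondow_inner n y n0 y01).1.
  by move=> x x01; rewrite !lee_fin sondow_integrand_ge0 // sondow_integrand_le.
have E : I_int R n = fine (\int[mu]_(y in itv01) \int[mu]_(x in itv01) (sondow_integrand n x y)%:E).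
  rewrite /I_int /Rintegral; congr fine; apply: eq_integral => y.
  rewrite inE /= in_itv /= => /inn /andP[h0 h1]; rewrite fineK //.
  by rewrite ge0_fin_numE //; apply: le_lt_trans h1 _; exact: ltry.
have := integral_itv01_le _ _ m1 inn.
by rewrite e1 !lee_fin E e1.
Qed.

End SondowIntegral.

(** * The rationality criterion *)

Section Criterion.
Variable R : realType.
Implicit Types (n i k m N : nat).
Local Notation d n := (lcm_upto (2 * n)).

Lemma lcm_upto_harmonic m N : (m <= N)%N ->
  (lcm_upto N)%:R * harmonic_sum R m
  = (\sum_(1 <= k < m.+1) lcm_upto N %/ k)%N%:R.
Proof.
move=> mN; rewrite /harmonic_sum mulr_sumr natr_sum; apply: eq_big_nat => k /andP[k0 km].
have kz : k%:R != 0 :> R by rewrite pnatr_eq0 -lt0n.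
apply: (mulIf kz); rewrite mulfVK // -[RHS]natrM divnK //.
by apply: dvdn_lcm_upto; rewrite k0 (leq_trans _ mN).
Qed.

Lemma lcm_upto_sondow_A n : exists a : nat, (d n)%:R * sondow_A R n = a%:R.
Proof.
exists (\sum_(i < n.+1) 'C(n, i) ^ 2 * \sum_(1 <= k < (n + i).+1) d n %/ k)%N.
rewrite /sondow_A mulr_sumr natr_sum; apply: eq_bigr => i _.
rewrite mulrCA lcm_upto_harmonic ?natrM ?natrX //.
by rewrite mul2n -addnn leq_add2l -ltnS.
Qed.

(** The linear form in 1, gamma and ln S_n with integer coefficients; the
    coefficient p of gamma is a multiple of lcm(1, ..., 2n), so it eventually clears
    any given denominator. *)
Lemma sondow_identity n : (0 < n)%N -> exists p a : nat, [/\ (0 < p)%N, (d n %| p)%N &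
  (d n)%:R * I_int R n = p%:R * euler_gamma R + ln (S_prod n)%:R - a%:R].
Proof.
move=> n0; have [a aE] := lcm_upto_sondow_A n.
exists (d n * \sum_(i < n.+1) 'C(n, i) ^ 2)%N, a; split.
- by rewrite muln_gt0 lcm_upto_gt0 big_ord_recl bin0.
- exact: dvdn_mulr.
rewrite (I_int_sondow R n n0).1 ln_S_prod // -aE natrM natr_sum.
under [in RHS]eq_bigr => i _ do rewrite natrX.
ring.
Qed.

(** lcm(1, ..., 2n) is at most K (225 / 16)^n and the integral is at most
    16 * 16^(-n), and 225 / 16 < 16. *)
Lemma lcm_upto_I_int_lt1 :
  exists N, forall n, (0 < n)%N -> (N <= n)%N -> 0 <= (d n)%:R * I_int R n < 1.
Proof.
have [K K0 dK] := lcm_upto_bound R.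
have cv : (fun n => K * 16 * (225 / 256) ^+ n) @ \oo --> (0 : R).
  by apply: cvg_geometric; rewrite ger0_norm; lra.
have [N _ HN] : \forall n \near \oo, K * 16 * (225 / 256) ^+ n < 1 :> R.
  by apply: (cvgr_lt (0 : R)) => //; exact: ltr01.
exists N => n n0 Nn; have [_ /andP[I0 I1]] := I_int_sondow R n n0.
rewrite mulr_ge0 //=; apply: le_lt_trans (HN n Nn).
apply: (@le_trans _ _ (K * (15 / 4) ^+ (2 * n) * 16^-1 ^+ n.-1)).
  by apply: ler_pM.
rewrite -!mulrA ler_wpM2l ?(ltW K0) //.
rewrite -{1 3}(prednK n0) exprM (_ : 225 / 256 = (15 / 4) ^+ 2 * 16^-1 :> R); last by lra.
move: ((15 / 4) ^+ 2 : R) => c; rewrite exprMn mulrCA [16^-1 ^+ n.-1.+1]exprS (mulrA 16) mulfV ?mul1r //.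
Qed.

(** If the fractional part of ln S_n is the multiple of the integral, then
    [sondow_identity] says that p gamma is an integer, for a positive p. *)
Lemma rational_of_frac_part n : (0 < n)%N ->
  frac_part (ln (S_prod n)%:R) = (d n)%:R * I_int R n ->
  exists q : rat, euler_gamma R = ratr q.
Proof.
move=> n0; have [p [a [p0 _ ->]]] := sondow_identity n n0.
rewrite /frac_part; move: (ln _) (Num.floor _) => l z E.
exists ((a%:Z - z)%:~R / p%:R).
rewrite fmorph_div rmorph_int rmorph_nat.
have pz : p%:R != 0 :> R by rewrite pnatr_eq0 -lt0n.
apply: (mulfI pz); rewrite [RHS]mulrC divfK // intrB -pmulrn; lra.
Qed.

(** Once n is at least the denominator of gamma, p gamma is an integer, so ln S_n
    differs from the multiple of the integral by an integer; that multiple lies in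
    [0, 1[, hence it is the fractional part. *)
Lemma frac_part_of_rational (q : rat) : euler_gamma R = ratr q ->
  exists N, forall n, (0 < n)%N -> (N <= n)%N ->
    frac_part (ln (S_prod n)%:R) = (d n)%:R * I_int R n.
Proof.
move=> gq; have [N HN] := lcm_upto_I_int_lt1.
exists (maxn N `|denq q|%N) => n n0; rewrite geq_max => /andP[Nn qn].
have [p [a [p0 dp E]]] := sondow_identity n n0.
have {HN} := HN n n0 Nn; rewrite {}E gq.
have /dvdnP[r pr] : (`|denq q| %| p)%N.
  apply: dvdn_trans dp; apply: dvdn_lcm_upto; rewrite absz_gt0 denq_eq0 /=.
  by apply: leq_trans qn _; rewrite mul2n -addnn leq_addr.
have -> : p%:R * ratr q = (r%:Z * numq q)%:~R :> R.
  have dq : (denq q)%:~R != 0 :> R by rewrite intr_eq0 denq_eq0.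
  rewrite pr /ratr intrM natrM -!pmulrn -mulrA; congr (_ * _).
  by rewrite natr_absz normr_denq mulrC divfK.
set z := (r%:Z * numq q)%R; set l := ln _ => /andP[h0 h1].
rewrite /frac_part (_ : Num.floor l = a%:Z - z).
  by rewrite intrB -pmulrn; ring.
apply: floor_def; rewrite !(intrD, intrB) -!pmulrn; apply/andP; split; lra.
Qed.

End Criterion.

Theorem theorem5 (R : realType) :
  ((exists n : nat, (0 < n)%N /\
      frac_part (ln (S_prod n)%:R) = (lcm_upto (2 * n))%:R * I_int R n)
   <->
   (exists N : nat, forall n : nat, (0 < n)%N -> (N <= n)%N ->
      frac_part (ln (S_prod n)%:R) = (lcm_upto (2 * n))%:R * I_int R n))
  /\
  ((exists N : nat, forall n : nat, (0 < n)%N -> (N <= n)%N ->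
      frac_part (ln (S_prod n)%:R) = (lcm_upto (2 * n))%:R * I_int R n)
   <->
   (exists q : rat, euler_gamma R = ratr q)).
Proof.
have ac : (exists n : nat, (0 < n)%N /\
      frac_part (ln (S_prod n)%:R) = (lcm_upto (2 * n))%:R * I_int R n) ->
    exists q : rat, euler_gamma R = ratr q.
  by case=> n [n0 /(rational_of_frac_part R n n0)].
have cb : (exists q : rat, euler_gamma R = ratr q) ->
    exists N : nat, forall n : nat, (0 < n)%N -> (N <= n)%N ->
      frac_part (ln (S_prod n)%:R) = (lcm_upto (2 * n))%:R * I_int R n.
  by case=> q; exact: frac_part_of_rational.
have ba : (exists N : nat, forall n : nat, (0 < n)%N -> (N <= n)%N ->
      frac_part (ln (S_prod n)%:R) = (lcm_upto (2 * n))%:R * I_int R n) ->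
    exists n : nat, (0 < n)%N /\
      frac_part (ln (S_prod n)%:R) = (lcm_upto (2 * n))%:R * I_int R n.
  by case=> N HN; exists N.+1; split=> //; exact: HN.
split; split; [by move/ac/cb | exact: ba | by move/ba/ac | exact: cb].
Qed.
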